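(* Let $L$ be a finite trim lattice with minimum $\hat0$ and maximum $\hat1$, and let $\Delta(L)$ be the order complex of its proper part $L\setminus\{\hat0,\hat1\}$. If $L$ is nuclear, then $\Delta(L)$ is homotopy equivalent to a sphere of dimension $r-2$, where $r$ is the number of atoms of $L$. If $L$ is not nuclear, then $\Delta(L)$ is contractible.
   Context: An element $x$ of a lattice $L$ is left modular if for all $y<z$ in $L$, $(y\vee x)\wedge z=y\vee(x\wedge z)$. A join-irreducible is an element other than $\hat0$ that is not the join of two strictly smaller elements; a meet-irreducible is an element other than $\hat1$ that is not the meet of two strictly larger elements. A lattice is trim if, for some $n$, it has a maximal chain of $n+1$ left modular elements and exactly $n$ join-irreducibles and exactly $n$ meet-irreducibles. A lattice is nuclear if $\hat1$ is the join of the atoms of $L$. The order complex of a poset is the simplicial complex of its chains. *)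

(* Defs.v *)
From HB Require Import structures.
From mathcomp Require Import all_boot all_order all_algebra.
From mathcomp Require Import all_classical all_reals all_analysis.

Set Implicit Arguments.
Unset Strict Implicit.
Unset Printing Implicit Defensive.

Import Order.TTheory GRing.Theory Num.Theory.
Import numFieldTopology.Exports.

Local Open Scope order_scope.

Definition is_chain d (P : finPOrderType d) (C : {set P}) : bool :=
  [forall x in C, forall y in C, x >=< y].

(* Faces include the empty one; it carries no point of the realization. *)
Definition order_complex d (P : finPOrderType d) (A : {set P}) :
    {set {set P}} :=
  [set C : {set P} | (C \subset A) && is_chain C].

Definition left_modular d (L : finTBLatticeType d) (x : L) : bool :=
  [forall y : L, forall z : L,
    (y < z) ==> ((y `|` x) `&` z == y `|` (x `&` z))].

Definition join_irreducible d (L : finTBLatticeType d) (x : L) : bool :=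
  (x != \bot) &&
  ~~ [exists y : L, exists z : L, [&& y < x, z < x & x == y `|` z]].

Definition meet_irreducible d (L : finTBLatticeType d) (x : L) : bool :=
  (x != \top) &&
  ~~ [exists y : L, exists z : L, [&& x < y, x < z & x == y `&` z]].

Definition trim d (L : finTBLatticeType d) : Prop :=
  exists n : nat,
    [/\ exists C : {set L},
          [/\ maxset (@is_chain d L) C,
              #|C| = n.+1 &
              forall x, x \in C -> left_modular x],
        #|[set x : L | join_irreducible x]| = n &
        #|[set x : L | meet_irreducible x]| = n].

Definition is_atom d (L : finTBLatticeType d) (x : L) : bool :=
  (\bot < x) && ~~ [exists y : L, (\bot < y) && (y < x)].

Definition atoms d (L : finTBLatticeType d) : {set L} :=
  [set x : L | is_atom x].

Definition nuclear d (L : finTBLatticeType d) : Prop :=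
  \join_(x in atoms L) x = \top.

Definition proper_part d (L : finTBLatticeType d) : {set L} :=
  [set x : L | (x != \bot) && (x != \top)].

Local Close Scope order_scope.
Local Open Scope classical_set_scope.
Local Open Scope ring_scope.

(* Barycentric coordinates, with the topology inherited from the product
   R^T; as T is finite this is the usual (weak) topology of the complex. *)
Definition realization (R : realType) (T : finType) (K : {set {set T}}) :
    topologicalType :=
  set_type [set p : {ptws T -> R} |
    [/\ forall v : T, 0 <= p v,
        \sum_(v : T) p v = 1 &
        [set v : T | p v != 0]%SET \in K]].

(* The (n-1)-dimensional sphere in R^n, empty for n = 0. The squares are
   written out because the library's norm on row vectors is the sup norm. *)
Definition unit_sphere (R : realType) (n : nat) : topologicalType :=
  set_type [set x : 'rV[R]_n | \sum_(i < n) x 0 i ^+ 2 = 1].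

(* The values of H outside `[0, 1] are irrelevant. *)
Definition homotopic (R : realType) (X Y : topologicalType) (f g : X -> Y) :
    Prop :=
  exists H : X * R -> Y,
    [/\ {within [set: X] `*` `[0, 1], continuous H},
        forall x, H (x, 0) = f x &
        forall x, H (x, 1) = g x].

Definition homotopy_equivalent (R : realType) (X Y : topologicalType) :
    Prop :=
  exists (f : X -> Y) (g : Y -> X),
    [/\ continuous f, continuous g,
        homotopic R (g \o f) id & homotopic R (f \o g) id].

Definition contractible (R : realType) (X : topologicalType) : Prop :=
  exists x0 : X, homotopic R (id : X -> X) (cst x0).

(* Main.v *)
(* Write phi x for the join of the atoms below x; phi <= id, so mass on a chain
   can be slid down along phi and phi induces a self-map of Delta(L) homotopic
   to the identity.  If the join c of all atoms is not the top, then c is above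
   the image of phi and the homotopy continues to the constant map c.

   If L is trim, then for every atom p some element lies above all other atoms
   but not above p: among the steps of the left modular chain, each of which
   is crossed by exactly one join-irreducible and one meet-irreducible, it is
   the meet-irreducible at the step crossed by p.  Hence in the nuclear case
   S |-> join of S is injective and never the top on proper subsets S of the
   atoms, and the image of phi is the face poset of the boundary of a simplex
   on r vertices.  Its realization is identified with the sphere by the levels
   t_i = (mass of elements above atom i) modulo constants; the mass at the join
   of S is recovered as the positive part of min_(i in S) t_i - max_(j notin S) t_j. *)
Require Import Defs.
From mathcomp Require Import all_boot all_order all_algebra.
From mathcomp Require Import all_classical all_reals all_analysis.
From mathcomp Require Import lra.

Set Implicit Arguments.
Unset Strict Implicit.
Unset Printing Implicit Defensive.

Import Order.TTheory GRing.Theory Num.Theory.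
Import numFieldTopology.Exports numFieldNormedType.Exports.

(** * Atoms of trim lattices *)

Section Trim.
Local Open Scope order_scope.
Variables (d : Order.disp_t) (L : finTBLatticeType d).
Implicit Types (x y z p q m : L) (C D : {set L}).

Let down x := [set e : L | e <= x].

Lemma is_chainP C :
  reflect {in C &, forall x y, x >=< y} (is_chain C).
Proof. by apply: (iffP 'forall_in_forall_inP) => H x y Hx Hy; exact: H. Qed.

(** The cardinality of the principal down-set is a strictly increasing rank, so [arg_minnP] and
    [arg_maxnP] applied to it yield minimal and maximal elements. *)
Lemma le_card_down x y : (#|down y| <= #|down x|)%N ->
  x <= y -> x = y.
Proof.
move=> cxy xy; apply/le_anti; rewrite xy /=.
have sub : down x \subset down y.
  by apply/fintype.subsetP => e; rewrite !inE => /le_trans; apply.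
have /eqP E : down x == down y by rewrite eqEcard sub.
by have : y \in down x by [rewrite E inE]; rewrite inE.
Qed.

Lemma chain_max C D x0 : is_chain C -> D \subset C -> x0 \in D ->
  exists2 x, x \in D & forall y, y \in D -> y <= x.
Proof.
move=> /is_chainP chC /fintype.subsetP sDC x0D.
case: (@arg_maxnP L x0 (mem D) (fun x => #|down x|) x0D) => x xD xmax.
exists x => // y yD; have /orP[xy|//] := chC _ _ (sDC _ xD) (sDC _ yD).
by rewrite (le_card_down (xmax _ yD) xy).
Qed.

Lemma chain_min C D x0 : is_chain C -> D \subset C -> x0 \in D ->
  exists2 x, x \in D & forall y, y \in D -> x <= y.
Proof.
move=> /is_chainP chC /fintype.subsetP sDC x0D.
case: (@arg_minnP L x0 (mem D) (fun x => #|down x|) x0D) => x xD xmin.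
exists x => // y yD; have /orP[//|yx] := chC _ _ (sDC _ xD) (sDC _ yD).
by rewrite (le_card_down (xmin _ yD) yx).
Qed.

(** A minimal [p] among the elements below [x] and not below [y] works: everything strictly under
    [p] lies below [y], and so does any join of two such elements. *)
Lemma join_irreducible_separation x y : ~~ (x <= y) ->
  exists p, [/\ join_irreducible p, p <= x & ~~ (p <= y)].
Proof.
move=> nxy; have Px : (x <= x) && ~~ (x <= y) by rewrite lexx.
case: (@arg_minnP L x (fun w => (w <= x) && ~~ (w <= y))
  (fun w => #|down w|) Px) => p /andP[px npy] pmin.
have below a : a < p -> a <= y.
  move=> ap; apply: contraT => nay.
  have := le_card_down (pmin a _) (ltW ap); rewrite (le_trans (ltW ap) px) nay.
  by move=> /(_ isT) E; rewrite E ltxx in ap.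
exists p; split=> //; apply/andP; split.
  by apply: contraNneq npy => ->; rewrite le0x.
apply/existsP => -[a /existsP[b /and3P[ap bp /eqP E]]].
by move: npy; rewrite E leUx !below.
Qed.

(** Dually, take a maximal element above [y] that is not above [x]. *)
Lemma meet_irreducible_separation x y : ~~ (x <= y) ->
  exists p, [/\ meet_irreducible p, y <= p & ~~ (x <= p)].
Proof.
move=> nxy; have Py : (y <= y) && ~~ (x <= y) by rewrite lexx.
case: (@arg_maxnP L y (fun w => (y <= w) && ~~ (x <= w))
  (fun w => #|down w|) Py) => p /andP[yp nxp] pmax.
have above a : p < a -> x <= a.
  move=> pa; apply: contraT => nxa.
  have := le_card_down (pmax a _) (ltW pa); rewrite (le_trans yp (ltW pa)) nxa.
  by move=> /(_ isT) E; rewrite E ltxx in pa.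
exists p; split=> //; apply/andP; split.
  by apply: contraNneq nxp => ->; rewrite lex1.
apply/existsP => -[a /existsP[b /and3P[pa pb /eqP E]]].
by move: nxp; rewrite E lexI !above.
Qed.

Lemma atom_join_irreducible p : is_atom p -> join_irreducible p.
Proof.
case/andP=> p0 /existsP Hp; rewrite /join_irreducible -lt0x p0 /=.
have E a : a < p -> a = \bot.
  by move=> ap; apply/eqP; apply: contraT; rewrite -lt0x => a0; case: Hp; exists a; rewrite a0.
apply/existsP => -[a /existsP[b /and3P[/E-> /E-> /eqP]]].
by rewrite joinxx => pE; rewrite pE ltxx in p0.
Qed.

Lemma exists_atom_below x : x != \bot -> exists2 p, is_atom p & p <= x.
Proof.
move=> x0; have Px : (x <= x) && (x != \bot) by rewrite lexx.
case: (@arg_minnP L x (fun w => (w <= x) && (w != \bot))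
  (fun w => #|down w|) Px) => p /andP[px p0] pmin.
exists p => //; rewrite /is_atom lt0x p0; apply/existsP => -[a /andP[a0 ap]].
have := le_card_down (pmin a _) (ltW ap); rewrite (le_trans (ltW ap) px) -lt0x a0.
by move=> /(_ isT) E; rewrite E ltxx in ap.
Qed.

Lemma atom_le_atom p q : is_atom p -> is_atom q -> p <= q -> p = q.
Proof.
case/andP=> p0 _ /andP[_ /existsP Hq] pq; apply/eqP; apply: contraT => npq.
by case: Hq; exists p; rewrite p0 lt_neqAle npq.
Qed.

(** * Steps of the left modular chain and the irreducibles crossing them *)

Section Chain.
Variables (n : nat) (C : {set L}).
Hypotheses (maxC : maxset (@is_chain d L) C) (cardC : #|C| = n.+1).
Hypothesis modC : forall x, x \in C -> left_modular x.
Hypothesis cardJ : #|[set x : L | join_irreducible x]| = n.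
Hypothesis cardM : #|[set x : L | meet_irreducible x]| = n.

Let chC : is_chain C := maxsetp maxC.
Let cmpC : {in C &, forall x y, x >=< y} := elimT (is_chainP C) chC.

Lemma maximal_chain_mem x : (forall y, y \in C -> x >=< y) -> x \in C.
Proof.
move=> cmpx; have chx : is_chain (x |: C).
  apply/is_chainP => a b /setU1P[->|aC] /setU1P[->|bC].
  - by rewrite comparablexx.
  - exact: cmpx.
  - by rewrite comparable_sym cmpx.
  - exact: cmpC.
by rewrite -(maxsetsup maxC chx (finset.subsetUr _ _)) setU11.
Qed.

Lemma bot_mem : \bot \in C.
Proof. by apply: maximal_chain_mem => y _; rewrite /Order.comparable le0x. Qed.

Lemma top_mem : \top \in C.
Proof. by apply: maximal_chain_mem => y _; rewrite /Order.comparable lex1 orbT. Qed.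

Definition consecutive x y := [/\ x \in C, y \in C, x < y &
  forall e, e \in C -> (e <= x) || (y <= e)].

Lemma predecessor y : y \in C -> y != \bot -> exists x, consecutive x y.
Proof.
move=> yC y0; have D0 : \bot \in [set e in C | e < y] by rewrite !inE bot_mem lt0x.
have sD : [set e in C | e < y] \subset C by apply/fintype.subsetP => e; rewrite inE => /andP[].
have [x] := chain_max chC sD D0; rewrite inE => /andP[xC xy] xmax; exists x; split=> // e eC.
apply/orP; have [->|ne] := eqVneq y e; first by right.
have /orP[ey|ye] := cmpC eC yC; last by right.
by left; apply: xmax; rewrite inE eC lt_neqAle eq_sym ne.
Qed.

Lemma successor x : x \in C -> x != \top -> exists y, consecutive x y.
Proof.
move=> xC x1; have D1 : \top \in [set e in C | x < e] by rewrite !inE top_mem ltx1.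
have sD : [set e in C | x < e] \subset C by apply/fintype.subsetP => e; rewrite inE => /andP[].
have [y] := chain_min chC sD D1; rewrite inE => /andP[yC xy] ymin; exists y; split=> // e eC.
apply/orP; have [->|ne] := eqVneq e x; first by left.
have /orP[ex|xe] := cmpC eC xC; first by left.
by right; apply: ymin; rewrite inE eC lt_neqAle eq_sym ne.
Qed.

(* Counting: each of the [n] steps of the chain is crossed by at least one
   join-irreducible, and each join-irreducible crosses exactly one step. *)
Lemma join_irreducible_unique x y p q : consecutive x y ->
  join_irreducible p -> join_irreducible q ->
  p <= y -> ~~ (p <= x) -> q <= y -> ~~ (q <= x) -> p = q.
Proof.
move=> [xC yC xy cxy] jp jq py px qy qx.
pose J := [set x : L | join_irreducible x].
pose h (p : L) := [set e in C | p <= e].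
(* The trace of [r] on the chain depends only on the step that [r] crosses. *)
have hE x' y' r : consecutive x' y' -> r <= y' -> ~~ (r <= x') -> h r = h y'.
  move=> [x'C y'C x'y' c'] ry rx; apply/setP => e; rewrite !inE.
  case: (boolP (e \in C)) => //= eC.
  apply/idP/idP => [re|]; last exact: le_trans.
  by case/orP: (c' _ eC) => // ex; rewrite (le_trans re ex) in rx.
have hinj : {in C &, injective h}.
  move=> a b aC bC E; apply/le_anti/andP; split.
    by have : b \in h a by [rewrite E inE bC lexx]; rewrite inE => /andP[].
  by have : a \in h b by [rewrite -E inE aC lexx]; rewrite inE => /andP[].
have sub : h @: (C :\ \bot) \subset h @: J.
  apply/fintype.subsetP => _ /imsetP[e /setD1P[e0 eC] ->].
  have [e' ee'] := predecessor eC e0; have [_ _ e'e _] := ee'.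
  have [r [jr re rne]] := join_irreducible_separation (negbT (lt_geF e'e)).
  by apply/imsetP; exists r; rewrite ?inE // (hE _ _ _ ee').
(* The [n] chain elements other than the bottom have distinct traces, all attained on [J]; as [J]
   has [n] elements, [h] is injective on it. *)
have : #|h @: J| == #|J|.
  rewrite eqn_leq leq_imset_card /=; apply: leq_trans (subset_leq_card sub).
  rewrite card_in_imset; last by move=> a b /setD1P[_ aC] /setD1P[_ bC]; exact: hinj.
  by move: cardC; rewrite (cardsD1 \bot) bot_mem add1n => -[->]; rewrite cardJ.
move=> /imset_injP; apply; rewrite ?inE //.
by rewrite (hE x y p) ?(hE x y q).
Qed.

(** The dual count: [h] records the part of the chain below [p], and a step is indexed by its lower
    end. *)
Lemma meet_irreducible_unique x y p q : consecutive x y ->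
  meet_irreducible p -> meet_irreducible q ->
  x <= p -> ~~ (y <= p) -> x <= q -> ~~ (y <= q) -> p = q.
Proof.
move=> [xC yC xy cxy] jp jq py px qy qx.
pose J := [set x : L | meet_irreducible x].
pose h (p : L) := [set e in C | e <= p].
have hE x' y' r : consecutive x' y' -> x' <= r -> ~~ (y' <= r) -> h r = h x'.
  move=> [x'C y'C x'y' c'] xr yr; apply/setP => e; rewrite !inE.
  case: (boolP (e \in C)) => //= eC.
  apply/idP/idP => [er|ex]; last exact: le_trans ex xr.
  by case/orP: (c' _ eC) => // ye; rewrite (le_trans ye er) in yr.
have hinj : {in C &, injective h}.
  move=> a b aC bC E; apply/le_anti/andP; split.
    by have : a \in h b by [rewrite -E inE aC lexx]; rewrite inE => /andP[].
  by have : b \in h a by [rewrite E inE bC lexx]; rewrite inE => /andP[].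
have sub : h @: (C :\ \top) \subset h @: J.
  apply/fintype.subsetP => _ /imsetP[e /setD1P[e1 eC] ->].
  have [e' ee'] := successor eC e1; have [_ _ e'e _] := ee'.
  have [r [jr re rne]] := meet_irreducible_separation (negbT (lt_geF e'e)).
  by apply/imsetP; exists r; rewrite ?inE // (hE _ _ _ ee').
have : #|h @: J| == #|J|.
  rewrite eqn_leq leq_imset_card /=; apply: leq_trans (subset_leq_card sub).
  rewrite card_in_imset; last by move=> a b /setD1P[_ aC] /setD1P[_ bC]; exact: hinj.
  by move: cardC; rewrite (cardsD1 \top) top_mem add1n => -[->]; rewrite cardM.
move=> /imset_injP; apply; rewrite ?inE //.
by rewrite (hE x y p) ?(hE x y q).
Qed.

(** The join lies between [x] and [y], hence is comparable with all of [C] and belongs to [C] by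
    maximality; being different from [x], it is [y]. *)
Lemma consecutive_join x y a : consecutive x y -> a <= y -> ~~ (a <= x) -> x `|` a = y.
Proof.
move=> [xC yC xy cxy] ay ax.
have xUa : x `|` a <= y by rewrite leUx (ltW xy).
have mem : x `|` a \in C.
  apply: maximal_chain_mem => e eC; case/orP: (cxy e eC) => H; rewrite /Order.comparable.
    by rewrite (le_trans H (leUl _ _)) orbT.
  by rewrite (le_trans xUa H).
apply/le_anti; rewrite xUa /=.
by case/orP: (cxy _ mem) => //; rewrite leUx (negbTE ax) andbF.
Qed.

(* [a] witnesses that [z] crosses the step [x < y]; left modularity of [x]
   keeps any other atom of [z] below the meet-irreducible of that step. *)
Lemma atom_below_step_meet_irreducible x y m a b z : consecutive x y ->
  meet_irreducible m -> x <= m -> ~~ (y <= m) ->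
  x `&` z = \bot -> a <= z -> a <= y -> is_atom a ->
  is_atom b -> b <= z -> ~~ (b <= y) -> b <= m.
Proof.
move=> xy jm xm ym xz az ay aA bA bz by'; have [xC _ _ _] := xy.
(* Otherwise [a] lies below the join of [b] and [x]. Left modularity of [x], applied to [b] and the
   join of [b] and [a], then equates these two, because [x] meets everything below [z] in the
   bottom. *)
have nyxb : ~~ (y <= b `|` x).
  apply/negP => yxb.
  have bba : b < b `|` a.
    rewrite lt_neqAle leUl andbT; apply: contra by' => /eqP E.
    have ab : a <= b by rewrite E leUr.
    by rewrite -(atom_le_atom aA bA ab).
  have := modC xC => /'forall_forallP /(_ b (b `|` a)); rewrite bba /= => /eqP.
  have -> : x `&` (b `|` a) = \bot.
    by apply/le_anti; rewrite le0x andbT -xz leI2 // leUx bz.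
  rewrite joinx0 meet_r => [E|]; first by rewrite E ltxx in bba.
  by rewrite leUx leUl (le_trans ay).
(* By uniqueness, a meet-irreducible above [b] and [x] but not above [y] is [m]. *)
have [m' [jm' + ym']] := meet_irreducible_separation nyxb.
rewrite leUx => /andP[bm' xm'].
by rewrite (meet_irreducible_unique xy jm jm').
Qed.

(** The witness is the meet-irreducible at the step [x < y] crossed by [p]. For another atom [q],
    this step is compared with the first one at which the chain meets the join [z] of [p] and [q]
    nontrivially. *)
Lemma atom_separation p : is_atom p ->
  exists2 m, ~~ (p <= m) & forall q, is_atom q -> q != p -> q <= m.
Proof.
(* A predicate true at the top and false at the bottom singles out a step, ending at the least chain
   element that satisfies it. *)
have first_step (f : L -> bool) : f \top -> ~~ f \bot ->
    exists x, exists2 y, consecutive x y &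
      [/\ f y, ~~ f x & forall e, e \in C -> f e -> y <= e].
  move=> f1 f0; have D1 : \top \in [set e in C | f e] by rewrite !inE top_mem.
  have sD : [set e in C | f e] \subset C by apply/fintype.subsetP => e; rewrite inE => /andP[].
  have [y] := chain_min chC sD D1; rewrite inE => /andP[yC fy] ymin.
  have y0 : y != \bot by apply: contraNneq f0 => <-.
  have [x xy] := predecessor yC y0; exists x, y => //; split => // [|e eC fe].
    have [xC _ ltxy _] := xy.
    apply/negP => fx; have yx : y <= x by apply: ymin; rewrite inE xC.
    by move: (lt_le_trans ltxy yx); rewrite ltxx.
  by apply: ymin; rewrite inE eC.
move=> pA; have p0 : ~~ (p <= \bot) by rewrite lex0 -lt0x; case/andP: pA.
have [x [y xy [py px ymin]]] := first_step (fun e => p <= e) (lex1 p) p0.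
have [xC yC ltxy cxy] := xy.
have [m [jm xm ym]] := meet_irreducible_separation (negbT (lt_geF ltxy)).
exists m.
  by apply: contra ym => pm; rewrite -(consecutive_join xy py px) leUx xm.
move=> q qA qp; have q0 : ~~ (q <= \bot) by rewrite lex0 -lt0x; case/andP: qA.
pose z := p `|` q; have pz : p <= z by rewrite leUl.
have qz : q <= z by rewrite leUr.
have meet_z r e : is_atom r -> r <= z -> r <= e -> e `&` z != \bot.
  move=> /andP[r0 _] rz re; rewrite -lt0x; apply: lt_le_trans r0 _.
  by rewrite lexI re.
have [||x' [y' xy' [y'z x'z y'min]]] := first_step (fun e => e `&` z != \bot).
- exact: meet_z pA pz (lex1 _).
- by rewrite meet0x eqxx.
have [x'C y'C ltxy' cxy'] := xy'.
move/negPn/eqP in x'z.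
have not_below r : is_atom r -> r <= z -> ~~ (r <= x').
  move=> rA rz; apply/negP => rx; have := meet_z _ _ rA rz rx.
  by rewrite x'z eqxx.
have [a aA] := exists_atom_below y'z; rewrite lexI => /andP[ay' az].
have [m' [jm' xm' ym']] := meet_irreducible_separation (negbT (lt_geF ltxy')).
have other b : is_atom b -> b <= z -> ~~ (b <= y') -> b <= m'.
  exact: (atom_below_step_meet_irreducible xy' jm' xm' ym' x'z az ay' aA).
(* No atom of [z] is below [x'], so those below [y'] cross the same step and coincide. *)
have below_unique r : is_atom r -> r <= z -> r <= y' -> r = a.
  move=> rA rz ry; apply: (join_irreducible_unique xy'); rewrite ?atom_join_irreducible //;
  exact: not_below.
(* If [p <= y'], the two steps coincide and [m' = m]; then [q], being different from [p], is not
   below [y'], and [other] applies. *)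
have [py'|npy'] := boolP (p <= y').
  have yE : y' = y.
    by apply/le_anti; rewrite ymin // y'min // (meet_z p).
  subst y'; have xE : x' = x.
    apply/le_anti/andP; split.
      by case/orP: (cxy _ x'C) => // yx'; move: (lt_le_trans ltxy' yx'); rewrite ltxx.
    by case/orP: (cxy' _ xC) => // yx; move: (lt_le_trans ltxy yx); rewrite ltxx.
  subst x'; rewrite (meet_irreducible_unique xy jm jm' xm ym xm' ym').
  apply: other => //; apply/negP => qy'.
  by move: qp; rewrite (below_unique q) // (below_unique p) // eqxx.
(* If neither atom is below [y'], then [m'] is above both, hence above [z], [a] and finally [y'], a
   contradiction. *)
have [qy'|nqy'] := boolP (q <= y'); last first.
  have : z <= m' by rewrite leUx !other.
  move=> zm; case/negP: ym'.
  by rewrite -(consecutive_join xy' ay' (not_below _ aA az)) leUx xm' (le_trans az).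
(* Here [q] crosses the chain before [p] does: [q <= y' <= x <= m]. *)
apply: le_trans qy' _; apply: le_trans xm.
case/orP: (cxy _ y'C) => // yy'; case/negP: npy'.
exact: le_trans py yy'.
Qed.

End Chain.

Lemma trim_atom_separation p : trim L -> is_atom p ->
  exists2 m, ~~ (p <= m) & forall q, is_atom q -> q != p -> q <= m.
Proof. by move=> [n [[C [maxC cC modC]] cJ cM]]; exact: (atom_separation maxC cC). Qed.

End Trim.

Local Open Scope classical_set_scope.
Local Open Scope ring_scope.

(** * Continuity of maps between realizations *)

Section Continuity.
Variable R : realType.

Lemma continuous_set_type (Z X : topologicalType) (A : set X) (f : Z -> A) :
  continuous (fun z => val (f z)) -> continuous f.
Proof. exact: continuous_comp_initial. Qed.

Lemma continuous_val (X : topologicalType) (A : set X) :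
  continuous (fun x : A => val x).
Proof. exact: initial_continuous. Qed.

Lemma continuous_ptws (Z : topologicalType) (T : finType) (f : Z -> {ptws T -> R}) :
  (forall v, continuous (fun z => f z v)) -> continuous f.
Proof.
move=> cf z; apply/cvg_sup => v U [_ [[W oW <-] Wz]].
by move=> sWU; apply: (filterS sWU); apply: cf; exact: open_nbhs_nbhs.
Qed.

Lemma continuous_eval (T : finType) (v : T) :
  continuous (fun p : {ptws T -> R} => p v).
Proof. exact: proj_continuous. Qed.

Lemma continuous_realization (Z : topologicalType) (T : finType) (K : {set {set T}})
    (f : Z -> realization R K) :
  (forall v, continuous (fun z => (val (f z) : T -> R) v)) -> continuous f.
Proof. by move=> cf; apply: continuous_set_type; exact: continuous_ptws. Qed.

Lemma continuous_coordinate (T : finType) (K : {set {set T}}) (v : T) :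
  continuous (fun p : realization R K => (val p : T -> R) v).
Proof.
move=> p; apply: (@continuous_comp _ _ _ (fun p : realization R K => val p)
  (fun q => q v)); [exact: continuous_val | exact: continuous_eval].
Qed.

Lemma continuous_rV (Z : topologicalType) n (f : Z -> 'rV[R]_n) :
  (forall j, continuous (fun z => f z 0 j)) -> continuous f.
Proof.
move=> cf z U [B BU sBU]; rewrite /nbhs /=.
suff : \forall z' \near z, forall j, B 0 j (f z' 0 j).
  by apply: filterS => z' H; apply: sBU => i j; rewrite ord1.
apply: filter_forall => j; apply: cf; exact: BU.
Qed.

Lemma continuous_mulr (Z : topologicalType) (f g : Z -> R) :
  continuous f -> continuous g -> continuous (fun z => f z * g z).
Proof. by move=> cf cg z; exact: cvgM (cf z) (cg z). Qed.

Lemma continuous_subr (Z : topologicalType) (f g : Z -> R) :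
  continuous f -> continuous g -> continuous (fun z => f z - g z).
Proof. by move=> cf cg z; exact: cvgB (cf z) (cg z). Qed.

Lemma continuous_invr (Z : topologicalType) (f : Z -> R) :
  continuous f -> (forall z, f z != 0) -> continuous (fun z => (f z)^-1).
Proof. by move=> cf f0 z; exact: cvgV (f0 z) (cf z). Qed.

Lemma continuous_normr (Z : topologicalType) (f : Z -> R) :
  continuous f -> continuous (fun z => `|f z|).
Proof. by move=> cf z; exact: cvg_norm (cf z). Qed.

Lemma continuous_minr (Z : topologicalType) (f g : Z -> R) :
  continuous f -> continuous g -> continuous (fun z => Num.min (f z) (g z)).
Proof. by move=> cf cg z; exact: continuous_min (cf z) (cg z). Qed.

Lemma continuous_maxr (Z : topologicalType) (f g : Z -> R) :
  continuous f -> continuous g -> continuous (fun z => Num.max (f z) (g z)).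
Proof. by move=> cf cg z; exact: continuous_max (cf z) (cg z). Qed.

Lemma continuous_sum_in (Z : topologicalType) (I : Type) (r : seq I) (P : pred I)
    (F : I -> Z -> R) :
  (forall i, P i -> continuous (F i)) ->
  continuous (fun z => \sum_(i <- r | P i) F i z).
Proof.
move=> cF; elim: r => [|i r IH].
  have -> : (fun z => \sum_(i <- [::] | P i) F i z) = cst 0.
    by apply/funext => z; rewrite big_nil.
  by move=> z; exact: cvg_cst.
have [Pi|nPi] := boolP (P i); last first.
  have -> // : (fun z => \sum_(i <- i :: r | P i) F i z) =
      (fun z => \sum_(i <- r | P i) F i z).
  by apply/funext => z; rewrite big_cons (negbTE nPi).
have -> : (fun z => \sum_(i <- i :: r | P i) F i z) =
    (fun z => F i z + \sum_(i <- r | P i) F i z).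
  by apply/funext => z; rewrite big_cons Pi.
by move=> z; apply: cvgD; [exact: cF | exact: IH].
Qed.

Lemma continuous_bigmin (Z : topologicalType) (I : Type) (r : seq I) (P : pred I)
    (F : I -> Z -> R) (e : Z -> R) :
  continuous e -> (forall i, P i -> continuous (F i)) ->
  continuous (fun z => \big[Num.min/e z]_(i <- r | P i) F i z).
Proof.
move=> ce cF; elim: r => [|i r IH].
  have -> // : (fun z => \big[Num.min/e z]_(i <- [::] | P i) F i z) = e.
  by apply/funext => z; rewrite big_nil.
have [Pi|nPi] := boolP (P i); last first.
  have -> // : (fun z => \big[Num.min/e z]_(i <- i :: r | P i) F i z) =
      (fun z => \big[Num.min/e z]_(i <- r | P i) F i z).
  by apply/funext => z; rewrite big_cons (negbTE nPi).
have -> : (fun z => \big[Num.min/e z]_(i <- i :: r | P i) F i z) =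
    F i \min (fun z => \big[Num.min/e z]_(i <- r | P i) F i z).
  by apply/funext => z; rewrite big_cons Pi.
by move=> z; apply: continuous_min; [exact: cF | exact: IH].
Qed.

End Continuity.

(** * Sliding mass down a chain *)

Section OrderComplex.
Variables (R : realType) (d : Order.disp_t) (P : finPOrderType d) (X : {set P}).
Implicit Types (p : P -> R) (v w x : P).

Definition chain_supported p :=
  (forall v, p v != 0 -> v \in X) /\
  (forall v w, p v != 0 -> p w != 0 -> (v >=< w)%O).

Lemma chain_supportedP p :
  [set v : P | p v != 0]%SET \in order_complex X <-> chain_supported p.
Proof.
rewrite inE; split=> [/andP[/fintype.subsetP sX /'forall_in_forall_inP ch]|[sX ch]].
  by split=> [v pv|v w pv pw]; [apply: sX | apply: ch]; rewrite inE.
apply/andP; split; first by apply/fintype.subsetP => v; rewrite inE; exact: sX.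
apply/'forall_in_forall_inP => v; rewrite inE => pv w; rewrite inE => pw.
exact: ch.
Qed.

Definition complex_point (p : {ptws P -> R}) (p0 : forall v, 0 <= p v)
    (p1 : \sum_v p v = 1) (ch : chain_supported p) :
    realization R (order_complex X) :=
  exist _ p (mem_set (And3 p0 p1 (proj2 (chain_supportedP p) ch))).

Lemma complex_pointP (p : realization R (order_complex X)) :
  [/\ forall v, 0 <= val p v, \sum_v val p v = 1 & chain_supported (val p)].
Proof.
by have [p0 p1 /chain_supportedP] := set_mem (valP p); split.
Qed.

(** For monotone [phi], this is the induced simplicial map in barycentric coordinates. *)
Definition push (phi : P -> P) p x : R := \sum_(v | phi v == x) p v.

Lemma sum_push phi p : \sum_x push phi p x = \sum_v p v.
Proof. by rewrite [RHS](partition_big phi predT). Qed.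

Lemma push_ge0 phi p x : (forall v, 0 <= p v) -> 0 <= push phi p x.
Proof. by move=> p0; apply: sumr_ge0. Qed.

Lemma push_neq0 phi p x : push phi p x != 0 -> exists2 v, phi v = x & p v != 0.
Proof.
move=> H; apply: contrapT => nH; case/eqP: H; apply: big1 => v /eqP vx.
by apply/eqP; apply: contraPT nH => pv; apply; exists v.
Qed.

(* At time [s] the bottom part of total mass [s] of a chain-supported [p] has
   been carried along [phi]; moving low elements first keeps the support of
   [slide] a chain, because then [phi u <= u <= w] whenever some mass has left
   [u] and some is still at [w]. *)
Definition moved p (s : R) v : R :=
  Num.min (p v) (Num.max 0 (s - \sum_(w | (w < v)%O) p w)).

Definition slide phi p (s : R) x : R := p x - moved p s x + push phi (moved p s) x.

Section Slide.
Variable phi : P -> P.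
Hypotheses (phi_homo : {homo phi : x y / (x <= y)%O})
  (phi_le : forall x, (phi x <= x)%O) (phiX : forall x, x \in X -> phi x \in X).
Variable p : P -> R.
Hypotheses (p_ge0 : forall v, 0 <= p v) (p_ch : chain_supported p).

Lemma moved_ge0 s v : 0 <= moved p s v.
Proof. by rewrite /moved le_min p_ge0 le_max lexx. Qed.

Lemma moved_le s v : moved p s v <= p v.
Proof. by rewrite /moved ge_min lexx. Qed.

Lemma moved_start s v : s <= 0 -> moved p s v = 0.
Proof.
move=> s0; have : 0 <= \sum_(w | (w < v)%O) p w by apply: sumr_ge0.
by move=> S0; rewrite /moved max_l ?min_r //; lra.
Qed.

Lemma sum_below_le v w : (v < w)%O ->
  \sum_(u | (u < v)%O) p u + p v <= \sum_(u | (u < w)%O) p u.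
Proof.
move=> vw; rewrite [leRHS](bigD1 v) //= [leRHS]addrC lerD2r.
rewrite [leRHS](bigID (fun u => u < v)%O) /= -[leLHS]addr0 lerD //; last exact: sumr_ge0.
rewrite le_eqVlt; apply/orP; left; apply/eqP/eq_bigl => u.
case: (boolP (u < v)%O); rewrite ?andbF // => uv.
by rewrite (lt_trans uv vw) lt_eqF.
Qed.

Lemma moved_end s v : \sum_v p v = 1 -> 1 <= s -> moved p s v = p v.
Proof.
move=> p1 s1; suff : \sum_(w | (w < v)%O) p w + p v <= 1.
  by move=> H; rewrite /moved min_l // le_max; apply/orP; right; lra.
rewrite -p1 [leRHS](bigD1 v) //= [leRHS]addrC lerD2r [leRHS](bigID (fun u => u < v)%O) /=.
rewrite -[leLHS]addr0 lerD //; last exact: sumr_ge0.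
rewrite le_eqVlt; apply/orP; left; apply/eqP/eq_bigl => u.
by case: (boolP (u < v)%O); rewrite ?andbF // => uv; rewrite lt_eqF.
Qed.

Lemma slide_ge0 s x : 0 <= slide phi p s x.
Proof.
by rewrite addr_ge0 ?push_ge0 ?subr_ge0 ?moved_le //; exact: moved_ge0.
Qed.

Lemma slide_sum s : \sum_x slide phi p s x = \sum_x p x.
Proof. by rewrite big_split /= sumrB sum_push subrK. Qed.

Lemma slide_start s x : s <= 0 -> slide phi p s x = p x.
Proof.
move=> s0; rewrite /slide moved_start // subr0 [push _ _ _]big1 ?addr0 // => v _.
exact: moved_start.
Qed.

Lemma slide_end s x : \sum_v p v = 1 -> 1 <= s -> slide phi p s x = push phi p x.
Proof.
move=> p1 s1; rewrite /slide moved_end // subrr add0r.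
by apply: eq_bigr => v _; rewrite moved_end.
Qed.

Lemma slide_neq0 s x : slide phi p s x != 0 ->
  moved p s x != p x \/ exists2 v, phi v = x & moved p s v != 0.
Proof.
rewrite /slide; have [->|ne _] := eqVneq (moved p s x) (p x); last by left.
by rewrite subrr add0r => /push_neq0; right.
Qed.

Lemma moved_neq0 s v : moved p s v != 0 -> p v != 0.
Proof.
apply: contra => /eqP pv; apply/eqP/le_anti.
by rewrite moved_ge0 -{1}pv moved_le.
Qed.

Lemma unmoved_neq0 s v : moved p s v != p v -> p v != 0.
Proof.
apply: contra => /eqP pv; rewrite pv; apply/eqP/le_anti.
by rewrite moved_ge0 -{1}pv moved_le.
Qed.

(** If instead [w < v], positive moved mass at [v] means that [s] exceeds the whole mass below [v],
    which includes that of [w]; so [w] would have been emptied. *)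
Lemma moved_le_unmoved s v w : moved p s v != 0 -> moved p s w != p w -> (v <= w)%O.
Proof.
move=> mv mw; have /orP[//|wv] := p_ch.2 _ _ (moved_neq0 mv) (unmoved_neq0 mw).
have [->|ne] := eqVneq v w; first by rewrite lexx.
have {}wv : (w < v)%O by rewrite lt_neqAle eq_sym ne.
have := sum_below_le wv => H; case/eqP: mw; rewrite /moved min_l // le_max.
apply/orP; right; rewrite lerBrDr.
have : 0 < moved p s v by rewrite lt_def mv moved_ge0.
by rewrite /moved lt_min lt_max ltxx /= subr_gt0 => /andP[_]; lra.
Qed.

Lemma slide_chain s : chain_supported (slide phi p s).
Proof.
split=> [x /slide_neq0[/unmoved_neq0|[v <- /moved_neq0]]|x y].
- exact: p_ch.1.
- by move=> pv; apply/phiX/p_ch.1.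
move=> /slide_neq0[mx|[v <- mv]] /slide_neq0[my|[w <- mw]].
- exact: p_ch.2 (unmoved_neq0 mx) (unmoved_neq0 my).
- rewrite /Order.comparable; apply/orP; right.
  exact: le_trans (phi_le w) (moved_le_unmoved mw mx).
- rewrite /Order.comparable; apply/orP; left.
  exact: le_trans (phi_le v) (moved_le_unmoved mv my).
- have /orP[H|H] := p_ch.2 _ _ (moved_neq0 mv) (moved_neq0 mw).
    by rewrite /Order.comparable (phi_homo H).
  by rewrite /Order.comparable (phi_homo H) orbT.
Qed.

End Slide.

Lemma continuous_slide (Z : topologicalType) phi (q : Z -> P -> R) (s : Z -> R) x :
  (forall v, continuous (fun z => q z v)) -> continuous s ->
  continuous (fun z => slide phi (q z) (s z) x).
Proof.
move=> cq cs; have cm v : continuous (fun z => moved (q z) (s z) v).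
  apply: continuous_minr => //; apply: continuous_maxr; first exact: cst_continuous.
  move=> z; apply: cvgB; first exact: cs.
  by apply: continuous_sum_in => w _; exact: cq.
move=> z; apply: cvgD; first by apply: cvgB; [exact: cq | exact: cm].
by apply: continuous_sum_in => w _; exact: cm.
Qed.

(* Two successive deformations in one formula: slide along [phi] on
   [[0, 1/2]], then contract linearly to the cone point [c] on [[1/2, 1]]. *)
Lemma contractible_order_complex (phi : P -> P) (c : P) :
  {homo phi : x y / (x <= y)%O} -> (forall x, (phi x <= x)%O) ->
  (forall x, x \in X -> phi x \in X) ->
  c \in X -> (forall x, x \in X -> (phi x <= c)%O) ->
  contractible R (realization R (order_complex X)).
Proof.
move=> phi_homo phi_le phiX cX phi_c.
(* [b] vanishes up to time 1/2 and grows linearly to 1 at time 1; clamping makes [K] describe a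
   point of the complex for every real [t]. *)
pose b (t : R) : R := Num.max 0 (Num.min 1 (t *+ 2 - 1)).
have b0 t : 0 <= b t by rewrite le_max lexx.
have b1 t : b t <= 1 by rewrite ge_max ler01 ge_min lexx.
pose K (p : P -> R) (t : R) : P -> R :=
  fun x => (1 - b t) * slide phi p (t *+ 2) x + b t * (x == c)%:R.
pose delta (x : P) : R := (x == c)%:R.
have delta1 : \sum_x delta x = 1.
  by rewrite (bigD1 c) //= /delta eqxx big1 ?addr0 // => x /negbTE->.
have delta_ch : chain_supported delta.
  have E x : delta x != 0 -> x = c.
    by rewrite /delta pnatr_eq0 eqb0 negbK => /eqP.
  by split=> [x /E->//|x y /E-> /E->]; rewrite comparablexx.
have K0 p t x : (forall v, 0 <= p v) -> 0 <= K p t x.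
  by move=> p0; rewrite addr_ge0 // mulr_ge0 ?subr_ge0 // slide_ge0.
have K1 p t : \sum_v p v = 1 -> \sum_x K p t x = 1.
  move=> p1; rewrite big_split /= -!mulr_sumr slide_sum p1.
  by rewrite -/(delta _) delta1 !mulr1 subrK.
have Kch p t : (forall v, 0 <= p v) -> \sum_v p v = 1 -> chain_supported p ->
    chain_supported (K p t).
  move=> p0 p1 ch; have [bt|bt] := eqVneq (b t) 0.
    suff -> : K p t = slide phi p (t *+ 2) by apply: slide_chain.
    by apply/funext => x; rewrite /K bt subr0 mul0r mul1r addr0.
  (* Once mass goes to [c], the slide is complete, so the remaining mass sits on values of [phi],
     all below [c]. *)
  have t2 : 1 <= t *+ 2.
    move: bt; rewrite /b; apply: contraR; rewrite -ltNge => t2.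
    by rewrite max_l // ge_min; apply/orP; right; lra.
  have E x : K p t x != 0 -> x = c \/ exists2 v, phi v = x & p v != 0.
    have [->|xc] := eqVneq x c; first by left.
    rewrite /K (negbTE xc) mulr0 addr0 mulf_eq0 negb_or => /andP[_].
    by rewrite slide_end // => /push_neq0; right.
  split=> [x /E[->//|[v <- pv]]|x y /E[->|[v <- pv]] /E[->|[w <- pw]]].
  - exact/phiX/ch.1.
  - by rewrite comparablexx.
  - by apply/orP; right; apply/phi_c/ch.1.
  - by apply/orP; left; apply/phi_c/ch.1.
  - have /orP[/phi_homo|/phi_homo] := ch.2 _ _ pv pw;
      by rewrite /Order.comparable => ->; rewrite ?orbT.
exists (@complex_point delta (fun v => ler0n _ _) delta1 delta_ch).
pose H (z : realization R (order_complex X) * R) :=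
  let: And3 p0 p1 ch := complex_pointP z.1 in
  @complex_point (K (val z.1) z.2) (fun x => K0 _ _ x p0) (K1 _ _ p1) (Kch _ _ p0 p1 ch).
have HE z : val (H z) = K (val z.1) z.2 by rewrite /H; case: complex_pointP.
have cK : continuous H.
  apply: continuous_realization => v.
  have -> : (fun z => (val (H z) : P -> R) v) = (fun z => K (val z.1) z.2 v).
    by apply/funext => z; rewrite HE.
  move=> z.
  have cv w : continuous (fun z : realization R (order_complex X) * R => val z.1 w).
    by move=> z'; apply: (@continuous_comp _ _ _ fst
      (fun q : realization R (order_complex X) => (val q : P -> R) w));
      [exact: cvg_fst | exact: continuous_coordinate].
  have ct : continuous (fun z : realization R (order_complex X) * R => z.2 *+ 2).
    have -> : (fun z : realization R (order_complex X) * R => z.2 *+ 2) =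
        (fun z => z.2 + z.2) by apply/funext => z'; rewrite mulr2n.
    by move=> z'; apply: cvgD; exact: cvg_snd.
  have cb : continuous (fun z : realization R (order_complex X) * R => b z.2).
    apply: continuous_maxr; first exact: cst_continuous.
    apply: continuous_minr; first exact: cst_continuous.
    by move=> z'; apply: cvgB; [exact: ct | exact: cvg_cst].
  have cS : continuous (fun z : realization R (order_complex X) * R =>
      slide phi (val z.1) (z.2 *+ 2) v).
    exact: (@continuous_slide _ phi _ _ v cv ct).
  apply: cvgD; apply: cvgM.
  - by apply: cvgB; [exact: cvg_cst | exact: cb].
  - exact: cS.
  - exact: cb.
  - exact: cvg_cst.
exists H; split; first exact: continuous_subspaceT.
- move=> p; apply: val_inj; rewrite HE; have [p0 p1 ch] := complex_pointP p.
  apply/funext => x; rewrite /K /=.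
  have -> : b 0 = 0 by rewrite /b mul0rn max_l // ge_min; apply/orP; right; lra.
  by rewrite slide_start ?mul0rn // subr0 mul1r mul0r addr0.
- move=> p; apply: val_inj; rewrite HE; apply/funext => x; rewrite /K /=.
  have -> : b 1 = 1 by rewrite /b min_l ?max_r //; lra.
  by rewrite subrr mul0r add0r mul1r.
Qed.

End OrderComplex.

(** * Levels and the boundary of a simplex *)

Section Levels.
Variables (R : realType) (d : Order.disp_t) (P : finPOrderType d).
Variables (I : finType) (A : P -> {set I}).
Hypothesis A_homo : forall x y, (x <= y)%O -> A x \subset A y.
Implicit Types (p q : P -> R) (u t : I -> R) (S : {set I}).

(** In the application [A v] is the set of atoms below [v], so this is the mass lying above the
    [i]-th atom. *)
Definition level p i : R := \sum_(v | i \in A v) p v.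

Lemma levelE p i : level p i = \sum_v p v * (i \in A v)%:R.
Proof.
rewrite /level big_mkcond; apply: eq_bigr => v _.
by case: ifP; rewrite ?mulr1 ?mulr0.
Qed.

(* The initial value of the minimum dominates all its terms. *)
Definition gap u S : R :=
  \big[Num.min/(\sum_k \sum_l `|u k - u l|)]_(kl : I * I | (kl.1 \in S) && (kl.2 \notin S))
     Num.max 0 (u kl.1 - u kl.2).

Lemma gap_shift u u' S : (forall k l, u k - u l = u' k - u' l) -> gap u S = gap u' S.
Proof.
move=> E; rewrite /gap; under eq_bigr do rewrite E.
by congr bigop; apply: eq_bigr => k _; apply: eq_bigr => l _; rewrite E.
Qed.

Lemma gap_eq u S c : 0 <= c ->
  (forall k l, k \in S -> l \notin S -> c <= Num.max 0 (u k - u l)) ->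
  (exists k l, [/\ k \in S, l \notin S & u k - u l <= c]) -> gap u S = c.
Proof.
move=> c0 cmin [k [l [kS lS ukl]]]; apply/le_anti/andP; split.
  by apply: (bigmin_inf (k, l)) => /=; [rewrite kS | rewrite ge_max c0].
apply: le_bigmin => [|[k' l'] /= /andP[k'S l'S]]; last exact: cmin.
apply: le_trans (cmin _ _ kS lS) _; rewrite ge_max; apply/andP; split.
  by apply: sumr_ge0 => k' _; apply: sumr_ge0.
rewrite (bigD1 k) //= (bigD1 l) //=.
have : 0 <= \sum_(i | i != l) `|u k - u i| by apply: sumr_ge0.
have : 0 <= \sum_(i | i != k) \sum_j `|u i - u j|.
  by apply: sumr_ge0 => i _; apply: sumr_ge0.
by have := ler_norm (u k - u l); lra.
Qed.

(** * Recovering a chain-supported mass from its levels *)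

Section ChainLevels.
Variable p : P -> R.
Hypotheses (p_ge0 : forall v, 0 <= p v)
  (p_ch : forall v w, p v != 0 -> p w != 0 -> (v >=< w)%O).

Lemma level_sets_chain v w : p v != 0 -> p w != 0 ->
  (A v \subset A w) || (A w \subset A v).
Proof. by move=> pv pw; apply/orP; case/orP: (p_ch pv pw) => /A_homo; [left|right]. Qed.

Lemma largest_level_set (D : pred P) v0 : (forall v, D v -> p v != 0) -> D v0 ->
  exists2 v, D v & forall w, D w -> A w \subset A v.
Proof.
move=> Dp Dv0; case: (@arg_maxnP P v0 D (fun v => #|A v|) Dv0) => v Dv vmax.
exists v => // w Dw; have /orP[vw|//] := level_sets_chain (Dp _ Dv) (Dp _ Dw).
have /eqP-> // : A v == A w by rewrite eqEcard vw; exact: vmax.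
Qed.

Lemma smallest_level_set (D : pred P) v0 : (forall v, D v -> p v != 0) -> D v0 ->
  exists2 v, D v & forall w, D w -> A v \subset A w.
Proof.
move=> Dp Dv0; case: (@arg_minnP P v0 D (fun v => #|A v|) Dv0) => v Dv vmin.
exists v => // w Dw; have /orP[//|wv] := level_sets_chain (Dp _ Dv) (Dp _ Dw).
have /eqP-> // : A w == A v by rewrite eqEcard wv; exact: vmin.
Qed.

(** Among the level sets of the support that do not contain [S], the largest contains all the
    others; an element of [S] outside it will do. *)
Lemma exists_new_index S : S != finset.set0 ->
  exists2 k, k \in S & forall v, p v != 0 -> k \in A v -> S \subset A v.
Proof.
case/set0Pn => k0 k0S; pose D v := (p v != 0) && ~~ (S \subset A v).
have Dp v : D v -> p v != 0 by case/andP.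
have [[v0 Dv0]|nD] := pselect (exists v, D v); last first.
  exists k0 => // v pv _; apply: contraPT nD => nS; apply; exists v.
  by rewrite /D pv.
have [v /andP[_ /subsetPn[k kS kv]] vmax] := largest_level_set Dp Dv0.
exists k => // w pw kw; apply: contraNT kv => nS.
by apply: (fintype.subsetP (vmax w _)); rewrite // /D pw.
Qed.

(** Dually, pick an index outside [S] from the smallest level set of the support that is not
    contained in [S]. *)
Lemma exists_lost_index S : S != finset.setT ->
  exists2 l, l \notin S & forall v, p v != 0 -> l \notin A v -> A v \subset S.
Proof.
move=> ST; have [l0 l0S] : exists l0, l0 \notin S.
  apply: contrapT => H; case/eqP: ST; apply/setP => l; rewrite inE.
  by apply: contrapT => /negP lS; apply: H; exists l.
pose D v := (p v != 0) && ~~ (A v \subset S).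
have Dp v : D v -> p v != 0 by case/andP.
have [[v0 Dv0]|nD] := pselect (exists v, D v); last first.
  exists l0 => // v pv _; apply: contraPT nD => nS; apply; exists v.
  by rewrite /D pv.
have [v /andP[_ /subsetPn[l lv lS]] vmin] := smallest_level_set Dp Dv0.
exists l => // w pw; apply: contraNT => nS.
by apply: (fintype.subsetP (vmin w _)); rewrite // /D pw.
Qed.

Lemma gap_level S : S != finset.set0 -> S != finset.setT ->
  gap (level p) S = \sum_(v | A v == S) p v.
Proof.
move=> S0 ST; have sumE : \sum_(v | A v == S) p v = \sum_v p v * (A v == S)%:R.
  by rewrite big_mkcond; apply: eq_bigr => v _; case: ifP; rewrite ?mulr1 ?mulr0.
have diffE k l : level p k - level p l =
    \sum_v p v * ((k \in A v)%:R - (l \in A v)%:R).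
  by rewrite !levelE -sumrB; apply: eq_bigr => v _; rewrite mulrBr.
apply: gap_eq; first exact: sumr_ge0.
  (* If this mass is nonzero, [S] occurs as a level set of the support, so every other one is
     comparable with it and the coefficients of [p v] can be compared one by one. *)
  move=> k l kS lS; have [->|] := eqVneq (\sum_(v | A v == S) p v) 0.
    by rewrite le_max lexx.
  move=> /eqP ne; have [v0 /eqP Av0 pv0] : exists2 v, A v == S & p v != 0.
    apply: contrapT => H; apply: ne; apply: big1 => v Av; apply/eqP.
    by apply: contraPT H => pv; apply; exists v.
  rewrite le_max; apply/orP; right; rewrite sumE diffE; apply: ler_sum => v _.
  have [->|pv] := eqVneq (p v) 0; first by rewrite !mul0r.
  apply: ler_wpM2l => //; have [->|AvS] := eqVneq (A v) S.
    by rewrite kS (negbTE lS) subr0.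
  have := level_sets_chain pv pv0; rewrite Av0 => /orP[] /fintype.subsetP sub.
    have -> : (l \in A v) = false by apply: contraNF lS => /sub.
    by rewrite subr0 ler0n.
  by rewrite (sub _ kS) subr_ge0 lern1 leq_b1.
(* For this pair, [k] in [A v] and [l] not in [A v] force [A v = S] on the support, whence the
   opposite inequality. *)
have [k kS knew] := exists_new_index S0.
have [l lS llost] := exists_lost_index ST.
exists k, l; split=> //; rewrite sumE diffE; apply: ler_sum => v _.
have [->|pv] := eqVneq (p v) 0; first by rewrite !mul0r.
apply: ler_wpM2l => //; have [kv|kv] := boolP (k \in A v); last first.
  by apply: le_trans (ler0n _ _); rewrite sub0r oppr_le0 ler0n.
have [lv|lv] := boolP (l \in A v); first by rewrite subrr ler0n.
by rewrite subr0 finset.eqEsubset knew // llost.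
Qed.

(** The largest level set of the support misses some [l], whose level is therefore 0, whereas any
    [k] in [A v0] has positive level. *)
Lemma level_not_constant v0 : p v0 != 0 -> A v0 != finset.set0 ->
  (forall v, p v != 0 -> A v != finset.setT) ->
  exists k l, level p k != level p l.
Proof.
move=> pv0 /set0Pn[k kv0] AT.
have [v pv vmax] := @largest_level_set (fun v => p v != 0) v0 (fun _ => id) pv0.
have /subsetPn[l _ lv] : ~~ (finset.setT \subset A v).
  by rewrite finset.subTset AT.
exists k, l; have -> : level p l = 0.
  apply: big1 => w lw; apply/eqP; apply: contraNT lv => pw.
  exact: (fintype.subsetP (vmax w pw)).
rewrite gt_eqF // /level (bigD1 v0) //=.
by rewrite ltr_pwDl ?lt_def ?pv0 ?p_ge0 //; exact: sumr_ge0.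
Qed.
End ChainLevels.
End Levels.

(** * Identification with the sphere through levels *)

Section Sphere.
Variables (R : realType) (d : Order.disp_t) (P : finPOrderType d) (X : {set P}).

Section Surjectivity.
Variables (I : finType) (A : P -> {set I}) (J : {set I} -> P).
Hypotheses (J_homo : forall S T : {set I}, S \subset T -> (J S <= J T)%O)
  (AJ : forall S, S != finset.set0 -> S != finset.setT -> A (J S) = S).

(** Induction on the number of nonzero levels: with [T] the set of their indices, the least of them,
    [t k], is subtracted from all levels in [T] and placed as mass at [J T]. *)
Lemma level_surjective (t : I -> R) : (forall i, 0 <= t i) -> (exists i, t i = 0) ->
  exists q : P -> R, [/\ forall v, 0 <= q v,
    forall v, q v != 0 -> exists S : {set I},
      [/\ v = J S, S != finset.set0 & S \subset [set i | t i != 0]%SET],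
    forall v w, q v != 0 -> q w != 0 -> (v >=< w)%O &
    forall i, level A q i = t i].
Proof.
have [n] := ubnP #|[set i | t i != 0]%SET|.
elim: n t => // n IH t cardt t0 [z tz].
set T := [set i | t i != 0]%SET in cardt *.
have [T0|/set0Pn[i0 i0T]] := eqVneq T finset.set0.
  exists (fun=> 0); split=> [//|v|v w|i]; rewrite ?eqxx //.
  rewrite /level big1 //; apply/esym/eqP; apply: contraT => ti.
  by have : i \in T by [rewrite inE]; rewrite T0 finset.in_set0.
have [k kT kmin] := @arg_minP _ R I i0 (mem T) t i0T.
have {}kT : k \in T := kT.
pose t' i := t i - t k * (i \in T)%:R.
have tk : t k != 0 by move: kT; rewrite inE.
have TE i : i \notin T -> t i = 0 by rewrite inE negbK => /eqP.
have t'0 i : 0 <= t' i.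
  rewrite /t'; have [iT|/TE->] := boolP (i \in T); last by rewrite mulr0 subr0.
  by rewrite mulr1 subr_ge0; exact: kmin.
have zT : z \notin T by rewrite inE tz eqxx.
have sT : [set i | t' i != 0]%SET \subset T :\ k.
  apply/fintype.subsetP => i; rewrite inE => ti; rewrite finset.in_setD1.
  move: ti; rewrite /t'.
  have [->|ik] := eqVneq i k; first by rewrite kT mulr1 subrr eqxx.
  have [//|iT] := boolP (i \in T).
  by rewrite TE // mulr0 subr0 eqxx.
have [||q [q0 qS qch qt]] := IH t' _ t'0.
- apply: (@leq_trans #|T|); last by rewrite -ltnS.
  rewrite [#|T|](cardsD1 k) kT add1n ltnS; exact: subset_leq_card.
- by exists z; rewrite /t' tz (negbTE zT) mulr0 subr0.
(* The vanishing level at [z] keeps [T] from being full, so [AJ] applies to it. *)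
have TT : T != finset.setT by apply: contraNneq zT => ->; rewrite inE.
have TN0 : T != finset.set0 by apply/set0Pn; exists i0.
(* The mass from the induction hypothesis sits on [J S] with [S] inside [T], so adding [J T] on top
   leaves a chain. *)
have qJ v : q v != 0 -> (v <= J T)%O.
  move=> /qS[S [-> _ sS]]; apply/J_homo/(fintype.subset_trans sS).
  exact: fintype.subset_trans sT (subD1set _ _).
exists (fun v => q v + t k * (v == J T)%:R); split.
- by move=> v; rewrite addr_ge0 // mulr_ge0 // ler0n.
- move=> v; have [->|_] := eqVneq v (J T); first by exists T.
  rewrite mulr0 addr0 => /qS[S [-> S0 sS]]; exists S; split => //.
  exact/(fintype.subset_trans sS)/(fintype.subset_trans sT)/subD1set.
- move=> v w; have [->|_] := eqVneq v (J T); have [->|_] := eqVneq w (J T).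
  + by rewrite comparablexx.
  + by rewrite mulr0 addr0 => _ /qJ H; rewrite /Order.comparable H orbT.
  + by rewrite mulr0 addr0 => /qJ H _; rewrite /Order.comparable H.
  + by rewrite !mulr0 !addr0; exact: qch.
- move=> i; rewrite levelE; under eq_bigr do rewrite mulrDl.
  rewrite big_split /= -levelE qt /t' (bigD1 (J T)) //= eqxx mulr1 AJ //.
  rewrite [X in _ + (_ + X)]big1 ?addr0 ?subrK // => v /negbTE->.
  by rewrite mulr0 mul0r.
Qed.

End Surjectivity.

Variables (m : nat) (A : P -> {set 'I_m.+1}) (J : {set 'I_m.+1} -> P).
Hypotheses (A_homo : forall x y, (x <= y)%O -> A x \subset A y)
  (J_homo : forall S T : {set 'I_m.+1}, S \subset T -> (J S <= J T)%O)
  (AJ : forall S, S != finset.set0 -> S != finset.setT -> A (J S) = S)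
  (JA : forall x, (J (A x) <= x)%O)
  (A_proper : forall x, x \in X -> A x != finset.set0 /\ A x != finset.setT)
  (JX : forall S, S != finset.set0 -> S != finset.setT -> J S \in X).

(** With [J] the join of a set of atoms, [phi] retracts [X] onto a copy of the poset of nonempty
    proper subsets of ['I_m.+1]. *)
Let phi x := J (A x).

Let phi_homo : {homo phi : x y / (x <= y)%O}.
Proof. by move=> x y /A_homo /J_homo. Qed.

Let phiX x : x \in X -> phi x \in X.
Proof. by case/A_proper; exact: JX. Qed.

Let A_phi x : x \in X -> A (phi x) = A x.
Proof. by case/A_proper; exact: AJ. Qed.

(** The inverse of taking levels, for masses concentrated on the fixed points of [phi]. *)
Definition from_levels (u : 'I_m.+1 -> R) x : R :=
  if (x \in X) && (phi x == x) then gap u (A x) else 0.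

Lemma from_levels_shift u u' : (forall k l, u k - u l = u' k - u' l) ->
  from_levels u = from_levels u'.
Proof.
by move=> E; apply/funext => x; rewrite /from_levels (gap_shift _ E).
Qed.

(** At a fixed point [x] the gap is the mass of all [v] with [A v = A x], that is, with [phi v = x];
    elsewhere no mass arrives, since [phi] maps [X] to its fixed points in [X]. *)
Lemma from_levels_level p : (forall v, 0 <= p v) -> chain_supported X p ->
  from_levels (level A p) = push phi p.
Proof.
move=> p0 [pX pch]; apply/funext => x; rewrite /from_levels; case: ifPn => [/andP[xX /eqP xE]|].
  have [A0 AT] := A_proper xX; rewrite gap_level // /push [LHS]big_mkcond [RHS]big_mkcond /=.
  apply: eq_bigr => v _; have [->|pv] := eqVneq (p v) 0; first by rewrite !if_same.
  suff -> : (A v == A x) = (phi v == x) by [].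
  apply/eqP/eqP => [E|<-]; first by rewrite /phi E.
  by rewrite A_phi //; exact: pX.
move=> nx; apply/esym/big1 => v /eqP vx; apply/eqP; apply: contraNT nx => /pX vX.
by rewrite -vx phiX //= /phi A_phi.
Qed.

(** Subtracting the minimum of [u] gives levels realized by some [q] supported on fixed points of
    [phi]. Such a [q] is recovered from its levels, so it equals [from_levels u]. *)
Lemma from_levels_spec u : (exists k l, u k != u l) ->
  [/\ forall x, 0 <= from_levels u x, chain_supported X (from_levels u),
      forall k l, level A (from_levels u) k - level A (from_levels u) l = u k - u l &
      0 < \sum_x from_levels u x].
Proof.
move=> [k [l ukl]].
have [i _ imin] := @arg_minP _ R 'I_m.+1 ord0 predT u isT.
pose t j := u j - u i.
have [||q [q0 qS qch qt]] := level_surjective J_homo AJ (t := t).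
- by move=> j; rewrite subr_ge0; exact: imin.
- by exists i; rewrite /t subrr.
have qP v : q v != 0 -> v \in X /\ phi v = v.
  move=> /qS[S [-> S0 sS]]; have ST : S != finset.setT.
    apply: contraTneq sS => ->; apply/negP => /fintype.subsetP/(_ i).
    by rewrite !inE /t subrr eqxx => /(_ isT).
  by rewrite /phi AJ // JX.
have qdiff k' l' : level A q k' - level A q l' = u k' - u l'.
  by rewrite !qt /t; lra.
have qE : from_levels u = q.
  rewrite (from_levels_shift (u' := level A q)); last by move=> *; rewrite qdiff.
  rewrite from_levels_level //; last by split=> // v /qP[].
  apply/funext => x; rewrite /push.
  have off v : v != x -> phi v == x -> q v = 0.
    move=> vx /eqP pv; apply/eqP; apply: contraNT vx => /qP[_ E].
    by rewrite -pv E.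
  rewrite big_mkcond (bigD1 x) //= big1 ?addr0 => [|v vx]; last first.
    by case: ifP => // /(off _ vx).
  case: ifPn => //; have [->//|/qP[_ ->]] := eqVneq (q x) 0.
  by rewrite eqxx.
rewrite qE; split=> //; first by split=> // v /qP[].
rewrite lt_def sumr_ge0 // andbT; apply: contraNneq ukl => /eqP.
rewrite psumr_eq0 // => /allP q00; have {}q00 v : q v = 0.
  by apply/eqP/q00; rewrite mem_index_enum.
by rewrite -subr_eq0 -qdiff /level !big1 // subrr.
Qed.

(* Levels matter only up to constants; they are normalized to vanish at
   [ord_max]. *)
Definition extend_zero (w : 'rV[R]_m) (i : 'I_m.+1) : R :=
  if unlift ord_max i is Some j then w 0 j else 0.

Definition offset (p : P -> R) (j : 'I_m) : R :=
  level A p (lift ord_max j) - level A p ord_max.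

Definition offset_norm p : R := Num.sqrt (\sum_j offset p j ^+ 2).

Lemma extend_zero_offset p c i :
  extend_zero (\row_j (c * offset p j)) i = c * (level A p i - level A p ord_max).
Proof.
rewrite /extend_zero; case: unliftP => [j|] ->; first by rewrite mxE.
by rewrite subrr mulr0.
Qed.

Lemma extend_zero_not_constant (w : 'rV[R]_m) : \sum_j w 0 j ^+ 2 = 1 ->
  exists k l, extend_zero w k != extend_zero w l.
Proof.
move=> w1; apply: contrapT => H.
have E j : w 0 j = 0.
  apply: contrapT => /eqP wj; apply: H; exists (lift ord_max j), ord_max.
  by rewrite /extend_zero liftK unlift_none.
by move: w1; rewrite big1 => [/esym/eqP|j _]; rewrite ?oner_eq0 // E expr0n.
Qed.

Local Notation K := (realization R (order_complex X)).

(** Elements of [X] have level sets neither empty nor full, so the levels of a point of the complex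
    are not all equal. *)
Lemma offset_norm_gt0 (p : K) : 0 < offset_norm (val p).
Proof.
have [p0 p1 [pX pch]] := complex_pointP p.
have [v pv] : exists v, val p v != 0.
  apply: contrapT => H; move: p1; rewrite big1 => [/esym/eqP|v _].
    by rewrite oner_eq0.
  by apply: contrapT => /eqP pv; apply: H; exists v.
have [||k [l kl]] := @level_not_constant R d P _ A A_homo (val p) p0 pch v pv.
- by have [] := A_proper (pX _ pv).
- by move=> w pw; have [] := A_proper (pX _ pw).
have off0 j : 0 <= offset (val p) j ^+ 2 by exact: sqr_ge0.
rewrite /offset_norm sqrtr_gt0 lt_def sumr_ge0 // andbT; apply: contra kl.
rewrite psumr_eq0 // => /allP H.
have E i : level A (val p) i = level A (val p) ord_max.
  case: (unliftP ord_max i) => [j|] -> //; apply/eqP; rewrite -subr_eq0 -sqrf_eq0.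
  by apply: H; rewrite mem_index_enum.
by rewrite (E k) (E l).
Qed.

Lemma to_sphere_subproof (p : K) :
  \sum_(j < m) (\row_j ((offset_norm (val p))^-1 * offset (val p) j)) 0 j ^+ 2 = 1 :> R.
Proof.
under eq_bigr do rewrite mxE exprMn.
have := offset_norm_gt0 p; rewrite -mulr_sumr exprVn sqr_sqrtr; last first.
  by apply: sumr_ge0 => j _; exact: sqr_ge0.
by rewrite sqrtr_gt0 => H; rewrite mulVf // gt_eqF.
Qed.

Definition to_sphere (p : K) : unit_sphere R m :=
  exist _ (\row_j ((offset_norm (val p))^-1 * offset (val p) j))
    (mem_set (to_sphere_subproof p)).

Definition from_sphere_fun (w : 'rV[R]_m) (x : P) : R :=
  (\sum_y from_levels (extend_zero w) y)^-1 * from_levels (extend_zero w) x.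

Lemma from_sphere_subproof (w : 'rV[R]_m) : \sum_j w 0 j ^+ 2 = 1 ->
  [/\ forall x, 0 <= from_sphere_fun w x, \sum_x from_sphere_fun w x = 1 &
      chain_supported X (from_sphere_fun w)].
Proof.
move=> /extend_zero_not_constant/from_levels_spec[q0 [qX qch] _ qsum]; split.
- by move=> x; rewrite mulr_ge0 // invr_ge0 ltW.
- by rewrite -mulr_sumr mulVf // gt_eqF.
have E x : from_sphere_fun w x != 0 -> from_levels (extend_zero w) x != 0.
  by rewrite /from_sphere_fun mulf_eq0 negb_or => /andP[].
by split=> [x /E/qX//|x y /E qx /E]; exact: qch.
Qed.

Definition from_sphere (w : unit_sphere R m) : K :=
  let: And3 q0 q1 ch := from_sphere_subproof (set_mem (valP w)) in
  @complex_point R d P X (from_sphere_fun (val w)) q0 q1 ch.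

Lemma val_from_sphere w : val (from_sphere w) = from_sphere_fun (val w).
Proof. by rewrite /from_sphere; case: from_sphere_subproof. Qed.

Lemma level_scale (c : R) (p : P -> R) i : level A (fun x => c * p x) i = c * level A p i.
Proof. by rewrite /level mulr_sumr. Qed.

Lemma to_sphereK w : to_sphere (from_sphere w) = w.
Proof.
apply: val_inj; have w1 := set_mem (valP w).
rewrite /to_sphere [LHS]/= val_from_sphere /from_sphere_fun.
have [q0 qch qdiff qsum] := from_levels_spec (extend_zero_not_constant w1).
set q := from_levels _ in q0 qch qdiff qsum *; set s := \sum_y q y in qsum *.
have offE j : offset (fun x => s^-1 * q x) j = s^-1 * val w 0 j.
  rewrite /offset !level_scale -mulrBr qdiff /extend_zero liftK unlift_none.
  by rewrite subr0.
(* Since [w] is a unit vector, the norm of the rescaled offsets is the scaling factor itself, and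
   [to_sphere] cancels it. *)
have nE : offset_norm (fun x => s^-1 * q x) = s^-1.
  rewrite /offset_norm; under eq_bigr do rewrite offE exprMn.
  by rewrite -mulr_sumr w1 mulr1 sqrtr_sqr ger0_norm // invr_ge0 ltW.
apply/rowP => j; rewrite mxE nE offE mulrA mulVf ?mul1r //.
by rewrite invr_neq0 // gt_eqF.
Qed.

(** Levels see an element only through [A], so only the image of [p] under [push phi] comes back;
    the scaling by [c] is undone by normalizing the total mass. *)
Lemma from_sphereK p : val (from_sphere (to_sphere p)) = push phi (val p).
Proof.
rewrite val_from_sphere /to_sphere [val (exist _ _ _)]/=.
set c := (offset_norm _)^-1.
have c0 : 0 < c by rewrite invr_gt0 offset_norm_gt0.
have [p0 p1 [pX pch]] := complex_pointP p.
have E : from_levels (extend_zero (\row_j (c * offset (val p) j))) =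
    push phi (fun x => c * val p x).
  rewrite -from_levels_level.
  - apply: from_levels_shift => k l; rewrite !extend_zero_offset !level_scale; lra.
  - by move=> v; rewrite mulr_ge0 // ltW.
  have H v : c * val p v != 0 -> val p v != 0.
    by rewrite mulf_eq0 negb_or => /andP[].
  by split=> [v /H/pX//|v v' /H pv /H]; exact: pch.
rewrite /from_sphere_fun E sum_push -mulr_sumr p1 mulr1; apply/funext => x.
by rewrite /push -mulr_sumr mulrA mulVf ?mul1r // gt_eqF.
Qed.

Lemma continuous_to_sphere : continuous to_sphere.
Proof.
have clev i : continuous (fun p : K => level A (val p) i).
  by rewrite /level; apply: continuous_sum_in => v _; exact: continuous_coordinate.
have coff j : continuous (fun p : K => offset (val p) j).
  exact: continuous_subr.
have cnorm : continuous (fun p : K => offset_norm (val p)).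
  move=> p; apply: (@continuous_comp _ _ _ (fun p : K => \sum_j offset (val p) j ^+ 2)
    (@Num.sqrt R)); last exact: sqrt_continuous.
  apply: continuous_sum_in => j _ p'.
  by apply: (@continuous_comp _ _ _ (fun p : K => offset (val p) j) (fun x : R => x ^+ 2));
    [exact: coff | exact: exprn_continuous].
apply: continuous_set_type; apply: continuous_rV => j.
have -> : (fun z => val (to_sphere z) 0 j) =
    (fun p : K => (offset_norm (val p))^-1 * offset (val p) j).
  by apply/funext => p; rewrite mxE.
apply: continuous_mulr => //; apply: continuous_invr => // p.
by rewrite gt_eqF // offset_norm_gt0.
Qed.

Lemma continuous_from_sphere : continuous from_sphere.
Proof.
have chom i : continuous (fun w : unit_sphere R m => extend_zero (val w) i).
  rewrite /extend_zero; case: unlift => [j|]; last exact: cst_continuous.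
  move=> w; apply: (@continuous_comp _ _ _ (fun w : unit_sphere R m => val w)
    (fun w : 'rV[R]_m => w 0 j)); [exact: continuous_val | exact: coord_continuous].
have cfl x : continuous (fun w : unit_sphere R m => from_levels (extend_zero (val w)) x).
  rewrite /from_levels; case: (_ && _); last exact: cst_continuous.
  apply: continuous_bigmin => [|kl _].
    apply: continuous_sum_in => k _; apply: continuous_sum_in => l _.
    by apply: continuous_normr; exact: continuous_subr.
  apply: continuous_maxr; first exact: cst_continuous.
  exact: continuous_subr.
apply: continuous_realization => x.
have -> : (fun z => (val (from_sphere z) : P -> R) x) =
    (fun w => (\sum_y from_levels (extend_zero (val w)) y)^-1 *
              from_levels (extend_zero (val w)) x).
  by apply/funext => w; rewrite val_from_sphere.
apply: continuous_mulr => //; apply: continuous_invr => [|w].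
  by apply: continuous_sum_in => y _; exact: cfl.
have [_ _ _ H] := from_levels_spec (extend_zero_not_constant (set_mem (valP w))).
by rewrite gt_eqF.
Qed.

(** One composite is the identity of the sphere; the other is [push phi], the end of the slide that
    starts at the identity. *)
Lemma sphere_order_complex : homotopy_equivalent R K (unit_sphere R m).
Proof.
exists to_sphere, from_sphere.
split; [exact: continuous_to_sphere | exact: continuous_from_sphere | |].
- pose S (p : P -> R) (t : R) := slide phi p (1 - t).
  have Sch (p : K) t : chain_supported X (S (val p) t).
    by have [p0 _ ch] := complex_pointP p; exact: slide_chain.
  have S0 (p : K) t x : 0 <= S (val p) t x.
    by have [p0 _ _] := complex_pointP p; exact: slide_ge0.
  have S1 (p : K) t : \sum_x S (val p) t x = 1.
    by have [_ p1 _] := complex_pointP p; rewrite slide_sum.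
  pose H (z : K * R) : K := @complex_point R d P X _ (S0 z.1 z.2) (S1 z.1 z.2) (Sch z.1 z.2).
  exists H; split.
  + apply: continuous_subspaceT; apply: continuous_realization => v.
    have cv w : continuous (fun z : K * R => val z.1 w).
      by move=> z; apply: (@continuous_comp _ _ _ fst (fun q : K => (val q : P -> R) w));
        [exact: cvg_fst | exact: continuous_coordinate].
    have ct : continuous (fun z : K * R => 1 - z.2).
      by move=> z; apply: cvgB; [exact: cvg_cst | exact: cvg_snd].
    exact: (@continuous_slide _ _ _ _ phi _ _ v cv ct).
  + move=> p; apply: val_inj; rewrite [RHS]/= from_sphereK.
    have [p0 p1 ch] := complex_pointP p; apply/funext => x.
    by rewrite [LHS]/= /S subr0 slide_end.
  + move=> p; apply: val_inj; have [p0 p1 ch] := complex_pointP p.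
    by apply/funext => x; rewrite [LHS]/= /S subrr slide_start.
- exists fst; split; [|by move=> w; rewrite /= to_sphereK|by []].
  by apply: continuous_subspaceT => z; exact: cvg_fst.
Qed.

End Sphere.

(** * Homotopy type of a trim lattice *)

Section TrimHomotopyType.
Variables (R : realType) (d : Order.disp_t) (L : finTBLatticeType d).
Implicit Types (x y : L).
Local Notation complex := (realization R (order_complex (proper_part L))).

Lemma not_nuclear_contractible : ~ nuclear L -> contractible R complex.
Proof.
move=> nucN; pose c : L := (\join_(a in atoms L) a)%O.
have c1 : c != \top%O by apply/eqP.
have c0 : c != \bot%O.
  (* If top and bottom coincide, the claim is [c1]; otherwise some atom lies below [c]. *)
  have [E|top0] := eqVneq (\top%O : L) \bot%O; first by rewrite -E.
  have [a aA _] := exists_atom_below top0; have [a0 _] := andP aA.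
  rewrite -lt0x; apply: lt_le_trans a0 _; apply: joins_sup.
  by rewrite inE.
pose phi x : L := (\join_(a in atoms L | a <= x) a)%O.
have phi_le x : (phi x <= x)%O by apply/joinsP => a /andP[].
apply: (@contractible_order_complex R d L (proper_part L) phi c) => //.
- move=> x y xy; apply/joinsP => a /andP[aA ax]; apply: joins_sup.
  by rewrite aA (le_trans ax xy).
- move=> x; rewrite !inE => /andP[x0 x1]; apply/andP; split.
    have [a aA ax] := exists_atom_below x0; have [a0 _] := andP aA.
    rewrite -lt0x; apply: lt_le_trans a0 _; apply: joins_sup.
    by rewrite inE aA.
  by apply: contraNneq x1 => E; have := phi_le x; rewrite E le1x.
- by rewrite inE c0.
- by move=> x _; apply/joinsP => a /andP[aA _]; exact: joins_sup.
Qed.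

Lemma nuclear_sphere : trim L -> nuclear L ->
  homotopy_equivalent R complex (unit_sphere R #|atoms L|.-1).
Proof.
(* Without atoms, nuclearity identifies top and bottom. The truncated predecessor gives
   [unit_sphere R 0], and both spaces are empty. *)
move=> trimL nucL; case cardA: #|atoms L| => [|m] /=.
  have top0 : \top%O = \bot%O :> L.
    rewrite -nucL; apply: big1 => a aA; have : (0 < #|atoms L|)%N.
      by apply/card_gt0P; exists a.
    by rewrite cardA.
  have X0 (p : complex) : False.
    have [_ p1 [pX _]] := complex_pointP p; move: p1; rewrite big1 => [/esym/eqP|v _].
      by rewrite oner_eq0.
    apply: contrapT => /eqP /pX; rewrite inE => /andP[/negP v0 _]; apply: v0.
    by rewrite -lex0 -top0 lex1.
  have Y0 (w : unit_sphere R 0) : False.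
    have := set_mem (valP w) => /= /eqP.
    by rewrite big_ord0 eq_sym oner_eq0.
  exists (fun p => False_rect _ (X0 p)), (fun w => False_rect _ (Y0 w)).
  split; [by move=> p; case: (X0 p) | by move=> w; case: (Y0 w) | |].
  - exists fst; split; [|by move=> p; case: (X0 p)|by move=> p; case: (X0 p)].
    by apply: continuous_subspaceT => z; case: (X0 z.1).
  - exists fst; split; [|by move=> p; case: (Y0 p)|by move=> p; case: (Y0 p)].
    by apply: continuous_subspaceT => z; case: (Y0 z.1).
pose at_ (i : 'I_m.+1) : L := enum_val (cast_ord (esym cardA) i).
have atA i : is_atom (at_ i) by have := enum_valP (cast_ord (esym cardA) i); rewrite inE.
have at_inj : injective at_ by move=> i j /enum_val_inj /cast_ord_inj.
have at_surj a : is_atom a -> exists i, a = at_ i.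
  move=> aA; have aL : a \in atoms L by rewrite inE.
  exists (cast_ord cardA (enum_rank_in aL a)).
  by rewrite /at_ cast_ord_comp cast_ord_id enum_rankK_in.
pose A x := [set i | (at_ i <= x)%O]%SET.
pose J (S : {set 'I_m.+1}) : L := (\join_(i in S) at_ i)%O.
have le_J i (S : {set 'I_m.+1}) : i \in S -> (at_ i <= J S)%O by move=> iS; exact: joins_sup.
(* The separating element [u] is above every atom except the [i]-th, hence above [J S]. *)
have nle_J i (S : {set 'I_m.+1}) : i \notin S -> ~~ (at_ i <= J S)%O.
  move=> iS; have [u iu ju] := trim_atom_separation trimL (atA i).
  apply: contra iu => /le_trans; apply; apply/joinsP => j jS; apply: ju => //.
  by apply: contraNneq iS => /at_inj <-.
have AJ S : A (J S) = S.
  apply/setP => i; rewrite inE; have [/le_J//|/nle_J/negbTE//] := boolP (i \in S).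
have J1 : J finset.setT = \top%O.
  apply/le_anti; rewrite lex1 -nucL /=; apply/joinsP => a; rewrite inE => /at_surj[i ->].
  by apply: le_J; rewrite inE.
have JA x : (J (A x) <= x)%O by apply/joinsP => i; rewrite inE.
apply: (@sphere_order_complex R d L (proper_part L) m A J) => //.
- by move=> x y xy; apply/fintype.subsetP => i; rewrite !inE => /le_trans; apply.
- by move=> S T /fintype.subsetP ST; apply/joinsP => i /ST; exact: le_J.
- move=> x; rewrite inE => /andP[x0 x1]; split.
    have [a /at_surj[i ->] ix] := exists_atom_below x0.
    by apply/set0Pn; exists i; rewrite inE.
  by apply: contraNneq x1 => AT; have := JA x; rewrite AT J1 le1x.
- move=> S S0 ST; rewrite inE; apply/andP; split.
    have /set0Pn[i iS] := S0; have [i0 _] := andP (atA i).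
    by rewrite -lt0x; exact: lt_le_trans i0 (le_J _ _ iS).
  by apply: contraNneq ST => JT; rewrite -(AJ S) JT -J1 AJ.
Qed.

End TrimHomotopyType.

Theorem theorem7 (R : realType) (d : Order.disp_t) (L : finTBLatticeType d)
    (trimL : trim L) :
  (nuclear L ->
     homotopy_equivalent R
       (realization R (order_complex (proper_part L)))
       (unit_sphere R #|atoms L|.-1)) /\
  (~ nuclear L ->
     contractible R (realization R (order_complex (proper_part L)))).
Proof. by split; [exact: nuclear_sphere | exact: not_nuclear_contractible]. Qed.
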